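(* Let $G$ be a connected graph of order $n$. For any vertex $x$ of $G$ with eccentricity $\mathrm{e}(x)$ we have $p_x(G) \leq n - \mathrm{e}(x)$. Thus $\mathrm{vp}(G) \leq n - \mathrm{rad}(G)$ and $\mathrm{vp}^-(G) \leq n - \mathrm{diam}(G)$.
   Context: All graphs are finite, undirected and simple. A $u,v$-geodesic is a shortest $u,v$-path. The eccentricity of $x$ is $\mathrm{e}(x) = \max_{v \in V(G)} d(x,v)$; $\mathrm{diam}(G)$ and $\mathrm{rad}(G)$ are the maximum and minimum eccentricity over all vertices. For a vertex $x$ of $G$, a set $S \subseteq V(G)$ is an $x$-position set if for every $y \in S$ no vertex of $S \setminus \{y\}$ lies on any $x,y$-geodesic in $G$. The $x$-position number $p_x(G)$ is the maximum cardinality of an $x$-position set of $G$. Define $\mathrm{vp}(G) = \max_{x \in V(G)} p_x(G)$ and $\mathrm{vp}^-(G) = \min_{x \in V(G)} p_x(G)$. *)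

(* Defs.v *)
From mathcomp Require Import all_boot.

Set Implicit Arguments.
Unset Strict Implicit.
Unset Printing Implicit Defensive.

Record sgraph := SGraph {
  vertex :> finType;
  adj : rel vertex;
  adj_sym : symmetric adj;
  adj_irrefl : irreflexive adj
}.

(* Connected graphs are nonempty, so that maxima and minima over the vertices
   make sense. *)
Definition connected (G : sgraph) : Prop :=
  0 < #|G| /\ forall u v : G, connect (@adj G) u v.

Section Defs.

Variable G : sgraph.
Implicit Types (u v x y z : G) (p : seq G) (S : {set G}).

(* The path with vertices u, p_0, p_1, ...; its length is size p. *)
Definition is_path u v p : bool :=
  [&& path (@adj G) u p, last u p == v & uniq (u :: p)].

(* Least length of a u,v-path. Paths have length < #|G|; the value is #|G| when
   u and v lie in different components. *)
Definition dist u v : nat :=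
  find (fun k => [exists p : k.-tuple G, is_path u v p]) (iota 0 #|G|).

Definition geodesic u v p : bool := is_path u v p && (size p == dist u v).

Definition ecc x : nat := \max_(v : G) dist x v.

Definition diam : nat := \max_(x : G) ecc x.

(* Here and in vpm, #|G| bounds all the values ranged over, so this is their
   minimum as soon as G has a vertex. *)
Definition rad : nat := \big[minn/#|G|]_(x : G) ecc x.

Definition position_set x S : bool :=
  [forall y in S, forall z in S :\ y, forall p : (dist x y).-tuple G,
     geodesic x y p ==> (z \notin x :: p)].

Definition posnum x : nat := \max_(S : {set G} | position_set x S) #|S|.

Definition vp : nat := \max_(x : G) posnum x.

Definition vpm : nat := \big[minn/#|G|]_(x : G) posnum x.

End Defs.

Arguments diam : clear implicits.
Arguments rad : clear implicits.
Arguments vp : clear implicits.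
Arguments vpm : clear implicits.

(* Main.v *)
(* Along a geodesic from x to a vertex y at distance e(x), every initial segment
   is again a geodesic, so of two vertices on it the nearer one lies on an
   x-geodesic to the farther one. Hence an x-position set contains at most one
   of the e(x) + 1 vertices of that geodesic. *)
Require Import Defs.
From mathcomp Require Import all_boot.

Lemma bigmin_leq (I : finType) (m : nat) (F : I -> nat) (i : I) :
  \big[minn/m]_(j : I) F j <= F i.
Proof.
elim: (index_enum I) (mem_index_enum i) => [//|j r IHr].
rewrite inE big_cons => /predU1P [<-|/IHr]; first exact: geq_minl.
exact/leq_trans/geq_minr.
Qed.

Lemma size_uniq_ltn_card (T : finType) (u : T) (p : seq T) :
  uniq (u :: p) -> size p < #|T|.
Proof. by move=> /card_uniqP up; rewrite -[(size p).+1]up max_card. Qed.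

Section Geodesics.

Variable G : sgraph.
Implicit Types (u v x : G) (p q : seq G) (S : {set G}).

(** Here [p] is a walk that may repeat vertices. Removing its cycles leaves a path [q] that is no
    longer; having no repeats, [q] has length below [#|G|], hence in the range searched by [find],
    which cannot pass over it. *)
Lemma dist_leq_path u p : path (@adj G) u p -> dist u (last u p) <= size p.
Proof.
case/shortenP=> q pq uq /(uniq_leq_size (subseq_uniq (subseq_cons q u) uq)).
apply: leq_trans; rewrite leqNgt; apply/negP => lt_q.
have /= := before_find 0 lt_q.
rewrite nth_iota ?(size_uniq_ltn_card _ _ _ uq) // add0n => /existsP[].
by exists (in_tuple q); rewrite /is_path pq eqxx uq.
Qed.

(** A connecting path makes the search in [dist] succeed before its default [#|G|], so the value
    found is the length of an actual path. *)
Lemma geodesic_exists u v : connect (@adj G) u v -> exists p, geodesic u v p.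
Proof.
case/connectP=> p0 /shortenP[p pp up _] ->.
set P := fun k => [exists p' : k.-tuple G, is_path u (last u p) p'].
have hasP : has P (iota 0 #|G|).
  apply/hasP; exists (size p).
    by rewrite mem_iota (size_uniq_ltn_card _ _ _ up).
  by apply/existsP; exists (in_tuple p); rewrite /is_path pp eqxx up.
have := nth_find 0 hasP; rewrite nth_iota; last by rewrite has_find size_iota in hasP.
by case/existsP=> q pq; exists q; rewrite /geodesic pq size_tuple eqxx.
Qed.

(** Cut and paste: a route [r] shorter than [p], followed by [q], would be a walk to [v] shorter
    than the distance. As [r ++ q] may repeat vertices, the bound for walks is the one applied. *)
Lemma geodesic_prefix u v p q :
  geodesic u v (p ++ q) -> geodesic u (last u p) p.
Proof.
rewrite /geodesic /is_path cat_path last_cat -cat_cons cat_uniq size_cat.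
case/andP=> /and3P[/andP[pp pq] /eqP lv /and3P[up _ _]] /eqP sz.
rewrite pp eqxx up eqn_leq dist_leq_path //= andbT leqNgt; apply/negP => lt_d.
have [r /andP[/and3P[pr /eqP lr _] /eqP sr]] : exists r, geodesic u (last u p) r.
  by apply: geodesic_exists; apply/connectP; exists p.
have := @dist_leq_path u (r ++ q).
rewrite cat_path last_cat lr lv pr pq -sz size_cat sr leq_add2r => /(_ isT).
by rewrite leqNgt lt_d.
Qed.

Lemma position_set_geodesic x v p S :
  position_set x S -> geodesic x v p -> #|S :&: [set z in x :: p]| <= 1.
Proof.
move=> posS gp; apply/card_le1_eqP => y z; rewrite !inE -!in_cons.
wlog le_yz : y z / index y (x :: p) <= index z (x :: p).
  move=> W Hy Hz; case/orP: (leq_total (index y (x :: p)) (index z (x :: p))).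
    by move=> /W; apply.
  by move=> /W e; apply/esym/e.
case/andP=> yS yp /andP[zS zp]; apply/eqP; apply: contraT => neq_yz.
set i := index z (x :: p) in le_yz.
have lt_i : i < size (x :: p) by rewrite index_mem.
(* Indices are counted in [x :: p], so [i] is the number of edges from [x] to [z]; the case [z = x]
   is [i = 0]. *)
have lastz : last x (take i p) = z.
  rewrite (last_nth x) size_takel // -[x :: take i p]/(take i.+1 (x :: p)).
  by rewrite nth_take // nth_index.
have gz : geodesic x z (take i p).
  rewrite -[X in geodesic x X]lastz.
  by apply: (@geodesic_prefix _ v _ (drop i p)); rewrite cat_take_drop.
have sz : size (take i p) == dist x z by case/andP: gz.
(* The farther vertex [z] is the endpoint of the geodesic, and [y] the vertex forbidden on it. *)
move/forall_inP/(_ z zS)/forall_inP/(_ y): posS.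
rewrite !inE eq_sym neq_yz yS => /(_ isT)/forallP/(_ (Tuple sz)).
rewrite gz => /negP[].
by rewrite -[x :: take i p]/(take i.+1 (x :: p)) in_take // ltnS.
Qed.

Lemma posnum_leq x : connected G -> posnum x <= #|G| - ecc x.
Proof.
case=> G0 conG; apply/bigmax_leqP => S posS.
have [v ->] : {v | ecc x = dist x v} by apply: eq_bigmax.
have [p gp] := geodesic_exists x v (conG x v).
have /andP[/and3P[_ _ up] /eqP <-] := gp.
have cardp : #|[set z in x :: p]| = (size p).+1.
  by rewrite cardsE; apply/card_uniqP.
(* With [c] vertices off the geodesic, [#|G| - size p] is [c + 1]: [S] has at most [c] elements off
   it and at most one on it. *)
rewrite -ltnS -subSn; last exact/ltnW/(size_uniq_ltn_card _ _ _ up).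
rewrite -(cardsC [set z in x :: p]) cardp addSn -addnS -addnS addKn.
rewrite -(cardsID [set z in x :: p] S) ltnS -addn1 addnC leq_add //.
  by rewrite setDE subset_leq_card // subsetIr.
exact: position_set_geodesic posS gp.
Qed.

End Geodesics.

Theorem lemma2p10 (G : sgraph) (n : nat) (hn : #|G| = n) (hG : connected G) :
  (forall x : G, posnum x <= n - ecc x) /\
  vp G <= n - rad G /\
  vpm G <= n - diam G.
Proof.
have le_posnum (x : G) : posnum x <= n - ecc x by rewrite -hn posnum_leq.
split=> //; split.
  apply/bigmax_leqP => x _; apply: leq_trans (le_posnum x) _.
  exact/leq_sub2l/bigmin_leq.
(* The minimum [vpm] is compared with the value at a vertex of maximum eccentricity. *)
have [x ->] : {x : G | diam G = ecc x} by apply: eq_bigmax; case: hG.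
exact/(leq_trans _ (le_posnum x))/bigmin_leq.
Qed.
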